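(* Let $f,g,h:\mathbb{R}\to\mathbb{R}$ be functions, $\lambda,\mu\in\mathbb{R}$, $x\in\mathbb{R}$ and $\beta\in(0,1]$. For each choice of direction (all superscripts $+$, or all superscripts $-$), $$[\lambda g,\mu f]_{\beta}^{\pm}(x)=\lambda\mu\,[g,f]_{\beta}^{\pm}(x),\qquad [g+f,h]_{\beta}^{\pm}(x)=[g,h]_{\beta}^{\pm}(x)+[f,h]_{\beta}^{\pm}(x).$$
   Context: For $0<\beta\le1$ the fractional co-variations are the limits (with $\epsilon>0$) $[f,g]_{\beta}^{+}(x)=\lim_{\epsilon\to0}\frac{f(x+\epsilon)-f(x)}{\epsilon^{\beta/2}}\cdot\frac{g(x+\epsilon)-g(x)}{\epsilon^{\beta/2}}$ and $[f,g]_{\beta}^{-}(x)=\lim_{\epsilon\to0}\frac{f(x)-f(x-\epsilon)}{\epsilon^{\beta/2}}\cdot\frac{g(x)-g(x-\epsilon)}{\epsilon^{\beta/2}}$. Convention: each identity is understood whenever the limits on its right-hand side exist in $[-\infty,\infty]$ and that side is a well-defined expression (no $\infty-\infty$; $0\cdot(\pm\infty)=0$). *)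

(* Defs.v *)
From HB Require Import structures.
From mathcomp Require Import all_boot all_order all_algebra.
From mathcomp Require Import all_classical all_reals all_analysis.
Set Implicit Arguments.
Unset Strict Implicit.
Unset Printing Implicit Defensive.
Import Order.TTheory GRing.Theory Num.Theory.
Import numFieldNormedType.Exports.
Local Open Scope classical_set_scope.
Local Open Scope ring_scope.

Inductive direction := Forward | Backward.

Definition increment (R : realType) (d : direction) (f : R -> R) (x e : R) : R :=
  match d with
  | Forward => f (x + e) - f x
  | Backward => f x - f (x - e)
  end.

(* Injected into [\bar R], so that limits taken of it may be infinite. *)
Definition covariation_quotient (R : realType) (d : direction) (beta : R)
    (f g : R -> R) (x e : R) : \bar R :=
  (increment d f x e / e `^ (beta / 2) *
   (increment d g x e / e `^ (beta / 2)))%:E.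

Definition covariation_exists (R : realType) (d : direction) (beta : R)
    (f g : R -> R) (x : R) : Prop :=
  cvg (covariation_quotient d beta f g x e @[e --> 0^'+]).

(* [f, g]_beta^+ (x) for [Forward] and [f, g]_beta^- (x) for [Backward].  The
   value is meaningful only under [covariation_exists], since [lim] returns a
   default element when there is no limit. *)
Definition covariation (R : realType) (d : direction) (beta : R)
    (f g : R -> R) (x : R) : \bar R :=
  lim (covariation_quotient d beta f g x e @[e --> 0^'+]).

(* Main.v *)
Require Import Defs.
From HB Require Import structures.
From mathcomp Require Import all_boot all_order all_algebra.
From mathcomp Require Import all_classical all_reals all_analysis.
Set Implicit Arguments.
Unset Strict Implicit.
Unset Printing Implicit Defensive.
Import Order.TTheory GRing.Theory Num.Theory.
Import numFieldNormedType.Exports.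
Local Open Scope classical_set_scope.
Local Open Scope ring_scope.

(** In either direction the increment is linear in the function, so at each fixed [e] the quotient
    is bilinear in the pair ([covariation_quotientZ], [covariation_quotientDl]). Both identities
    then pass to the limit in [\bar R], and [covariation_cvg] turns each resulting convergence into
    existence and value at once. *)

Lemma incrementZ (R : realType) (d : direction) (c : R) (f : R -> R) (x e : R) :
  increment d (fun t => c * f t) x e = c * increment d f x e.
Proof. by case: d; rewrite /increment mulrBr. Qed.

Lemma incrementD (R : realType) (d : direction) (f g : R -> R) (x e : R) :
  increment d (fun t => f t + g t) x e = increment d f x e + increment d g x e.
Proof. by case: d; rewrite /increment opprD addrACA. Qed.

Lemma covariation_quotientZ (R : realType) (d : direction) (beta a b : R)
    (f g : R -> R) (x e : R) :
  covariation_quotient d beta (fun t => a * f t) (fun t => b * g t) x e =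
  ((a * b)%:E * covariation_quotient d beta f g x e)%E.
Proof.
by rewrite /covariation_quotient !incrementZ -EFinM -!(mulrA _ _ _^-1) mulrACA.
Qed.

Lemma covariation_quotientDl (R : realType) (d : direction) (beta : R)
    (f g h : R -> R) (x e : R) :
  covariation_quotient d beta (fun t => f t + g t) h x e =
  (covariation_quotient d beta f h x e + covariation_quotient d beta g h x e)%E.
Proof. by rewrite /covariation_quotient incrementD -EFinD !mulrDl. Qed.

(** Limits in [\bar R] are unique because the space is Hausdorff, so [lim] must return [l] rather
    than its default. *)
Lemma covariation_cvg (R : realType) (d : direction) (beta : R)
    (f g : R -> R) (x : R) (l : \bar R) :
  covariation_quotient d beta f g x e @[e --> 0^'+] --> l ->
  covariation_exists d beta f g x /\ covariation d beta f g x = l.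
Proof.
by move=> fgl; split; [exact: cvgP fgl | exact/cvg_lim/fgl/ereal_hausdorff].
Qed.

Theorem proposition3 (R : realType) (f g h : R -> R) (lambda mu x beta : R)
    (beta_gt0 : 0 < beta) (beta_le1 : beta <= 1) (d : direction) :
  (covariation_exists d beta g f x ->
     covariation_exists d beta
       (fun t => lambda * g t) (fun t => mu * f t) x /\
     covariation d beta (fun t => lambda * g t) (fun t => mu * f t) x =
       ((lambda * mu)%:E * covariation d beta g f x)%E) /\
  (covariation_exists d beta g h x ->
   covariation_exists d beta f h x ->
   (covariation d beta g h x +? covariation d beta f h x)%E ->
     covariation_exists d beta (fun t => g t + f t) h x /\
     covariation d beta (fun t => g t + f t) h x =
       (covariation d beta g h x + covariation d beta f h x)%E).
Proof.
split=> [gf | gh fh ghDfh]; apply: covariation_cvg.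
(* Multiplication by a finite constant preserves limits in [\bar R], infinite ones included: for the
   constant 0 both sides vanish, since 0 times an infinity is 0. *)
- rewrite (eq_fun (covariation_quotientZ d beta lambda mu g f x)).
  exact: cvgeZl.
(* Addition preserves limits at this pair because [ghDfh] excludes opposite infinities. *)
- rewrite (eq_fun (covariation_quotientDl d beta g f h x)).
  exact: cvgeD.
Qed.
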